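(* Consider a robust MDP $(\mathcal{S},\mathcal{A},\mu,\gamma,\mathcal{U})$ with $\mu(s)>0$ for all $s\in\mathcal{S}$. Suppose that at least one of the following two conditions holds: (A) for every policy $\pi\in\Pi$, the set $\mathcal{P}^\pi=\{P:(c,P)\in\mathcal{U}^\pi\}$ of worst-case transition kernels is a singleton; (B) for every policy $\pi\in\Pi$, the set $\mathcal{Q}^\pi=\{Q^\pi_{c,P}:(c,P)\in\mathcal{U}^\pi\}$ of worst-case action-value functions is a singleton. Then the robust total cost $J_{\mathcal{U}}$ is subgradient-dominant with constant $D=\big((1-\gamma)\min_s\mu(s)\big)^{-1}$; that is, for every $\pi\in\Pi$, $$J_{\mathcal{U}}(\pi)-\min_{\pi'\in\Pi}J_{\mathcal{U}}(\pi')\le D\,\min_{g\in\partial J_{\mathcal{U}}(\pi)}\ \max_{\pi'\in\Pi}\ \sum_{s,a}\big(\pi(a\mid s)-\pi'(a\mid s)\big)g(s,a).$$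
   Context: A robust MDP is a tuple $(\mathcal{S},\mathcal{A},\mu,\gamma,\mathcal{U})$ with finite state and action sets $\mathcal{S},\mathcal{A}$, initial distribution $\mu$ on $\mathcal{S}$, discount factor $\gamma\in[0,1)$, and a nonempty compact set $\mathcal{U}$ of models $(c,P)$, each consisting of a cost function $c:\mathcal{S}\times\mathcal{A}\to[0,1]$ and a transition kernel $P(\cdot\mid s,a)$ on $\mathcal{S}$. A policy assigns to each $s$ a distribution $\pi(\cdot\mid s)$ on $\mathcal{A}$; $\Pi\subset\mathbb{R}^{\mathcal{S}\times\mathcal{A}}$ is the set of all policies. $J_{c,P}(\pi)=\mathbb{E}^\pi_P[\sum_{h\ge0}\gamma^h c(s_h,a_h)]$ with $s_0\sim\mu$, $a_h\sim\pi(\cdot\mid s_h)$, $s_{h+1}\sim P(\cdot\mid s_h,a_h)$; $J_{\mathcal{U}}(\pi)=\max_{(c,P)\in\mathcal{U}}J_{c,P}(\pi)$; $\mathcal{U}^\pi=\arg\max_{(c,P)\in\mathcal{U}}J_{c,P}(\pi)$ is the set of worst-case models. $Q^\pi_{c,P}(s,a)$ is the expected discounted total cost under $\pi$ and $(c,P)$ starting from $(s,a)$, and $d^\pi_P(s)=(1-\gamma)\mathbb{E}^\pi_P[\sum_{h\ge0}\gamma^h\mathbf{1}\{s_h=s\}]$. The gradient is $(\nabla J_{c,P}(\pi))(s,a)=\frac{1}{1-\gamma}d^\pi_P(s)Q^\pi_{c,P}(s,a)$ and the (Fréchet) subdifferential of $J_{\mathcal{U}}$ is $\partial J_{\mathcal{U}}(\pi)=\mathrm{conv}\{\nabla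 J_{c,P}(\pi):(c,P)\in\mathcal{U}^\pi\}$. *)

(* Defs.v *)
From HB Require Import structures.
From mathcomp Require Import all_boot all_order all_algebra.
From mathcomp Require Import all_classical all_reals all_analysis.

Set Implicit Arguments.
Unset Strict Implicit.
Unset Printing Implicit Defensive.

Import Order.TTheory GRing.Theory Num.Theory.
Import numFieldNormedType.Exports.

(* Gives [S -> A -> R] and [S -> A -> S -> R] the product topology; for finite
   [S] and [A] this is the Euclidean topology. *)
Export ArrowAsProduct.

Local Open Scope classical_set_scope.
Local Open Scope ring_scope.

Section Extrema.
Variable R : realType.
Implicit Type X : set R.

(* Attained extrema; the default value 0 is only taken by sets that have no
   greatest (resp. least) element. *)
Definition setmax X : R := xget 0 [set x | X x /\ ubound X x].
Definition setmin X : R := xget 0 [set x | X x /\ lbound X x].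

Definition convex_hull (V : lmodType R) (X : set V) : set V :=
  [set x | exists (n : nat) (l : 'I_n -> R) (v : 'I_n -> V),
     [/\ forall i, 0 <= l i, \sum_i l i = 1, forall i, X (v i)
       & x = \sum_i l i *: v i]].

End Extrema.

Section RobustMDP.
Variables (R : realType) (S A : finType).

Definition is_distribution (T : finType) (p : T -> R) : Prop :=
  (forall x, 0 <= p x) /\ \sum_x p x = 1.

Definition kernel : Type := S -> A -> S -> R.
Definition model : Type := ((S -> A -> R) * (S -> A -> S -> R))%type.

Definition is_model (m : model) : Prop :=
  (forall s a, 0 <= m.1 s a <= 1) /\ (forall s a, is_distribution (m.2 s a)).

Definition policies : set (S -> A -> R) :=
  [set pi | forall s, is_distribution (pi s)].

(* Probability of the trajectory [w 0, ..., w n] of state-action pairs when the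
   first pair has law [nu]. *)
Definition traj_prob (P : kernel) (pi : S -> A -> R) (nu : S * A -> R) (n : nat)
    (w : {ffun 'I_n.+1 -> S * A}) : R :=
  nu (w ord0) *
  \prod_(h < n) (let x := w (widen_ord (leqnSn n) h) in
                 let y := w (lift ord0 h) in
                 P x.1 x.2 y.1 * pi y.1 y.2).

(* [E [\sum_(0 <= h <= n) gamma ^ h * f (s_h, a_h)]] *)
Definition truncated_total (gamma : R) (P : kernel) (pi : S -> A -> R)
    (nu : S * A -> R) (f : S -> A -> R) (n : nat) : R :=
  \sum_(w : {ffun 'I_n.+1 -> S * A})
     traj_prob P pi nu w * \sum_(h < n.+1) gamma ^+ h * f (w h).1 (w h).2.

(* [E [\sum_(h >= 0) gamma ^ h * f (s_h, a_h)]]: by dominated convergence, the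
   limit of the expectations of the partial sums, each of which depends only on
   the law of a finite trajectory. *)
Definition discounted_total (gamma : R) (P : kernel) (pi : S -> A -> R)
    (nu : S * A -> R) (f : S -> A -> R) : R :=
  limn (truncated_total gamma P pi nu f).

(* Law of [(s_0, a_0)] when [s_0] has law [mu] and [a_0] has law [pi s_0]. *)
Definition init_law (mu : S -> R) (pi : S -> A -> R) : S * A -> R :=
  fun x => mu x.1 * pi x.1 x.2.

Definition total_cost (mu : S -> R) (gamma : R) (m : model)
    (pi : S -> A -> R) : R :=
  discounted_total gamma m.2 pi (init_law mu pi) m.1.

Definition action_value (gamma : R) (m : model) (pi : S -> A -> R) :
    S -> A -> R :=
  fun s a => discounted_total gamma m.2 pi (fun x => (x == (s, a))%:R) m.1.

Definition occupancy (mu : S -> R) (gamma : R) (P : kernel)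
    (pi : S -> A -> R) : S -> R :=
  fun s => (1 - gamma) *
    discounted_total gamma P pi (init_law mu pi) (fun s' _ => (s' == s)%:R).

Definition grad_total_cost (mu : S -> R) (gamma : R) (m : model)
    (pi : S -> A -> R) : S -> A -> R :=
  fun s a => (1 - gamma)^-1 * occupancy mu gamma m.2 pi s
             * action_value gamma m pi s a.

Definition robust_cost (mu : S -> R) (gamma : R) (U : set model)
    (pi : S -> A -> R) : R :=
  setmax [set total_cost mu gamma m pi | m in U].

Definition worst_models (mu : S -> R) (gamma : R) (U : set model)
    (pi : S -> A -> R) : set model :=
  [set m | U m /\ forall m', U m' ->
             total_cost mu gamma m' pi <= total_cost mu gamma m pi].

Definition worst_kernels (mu : S -> R) (gamma : R) (U : set model)
    (pi : S -> A -> R) : set kernel :=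
  [set m.2 | m in worst_models mu gamma U pi].

Definition worst_Q (mu : S -> R) (gamma : R) (U : set model)
    (pi : S -> A -> R) : set (S -> A -> R) :=
  [set action_value gamma m pi | m in worst_models mu gamma U pi].

Definition subdifferential (mu : S -> R) (gamma : R) (U : set model)
    (pi : S -> A -> R) : set (S -> A -> R) :=
  convex_hull
    [set grad_total_cost mu gamma m pi | m in worst_models mu gamma U pi].

Definition is_singleton (T : Type) (X : set T) : Prop := exists x, X = [set x].

Definition subgradient_dominant (F : (S -> A -> R) -> R)
    (dF : (S -> A -> R) -> set (S -> A -> R)) (D : R) : Prop :=
  forall pi, policies pi ->
    F pi - setmin [set F pi' | pi' in policies]
    <= D * setmin [set setmax [set \sum_s \sum_a (pi s a - pi' s a) * g s a
                              | pi' in policies]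
                  | g in dF pi].

End RobustMDP.

(* Main.v *)
Require Import Defs.
From HB Require Import structures.
From mathcomp Require Import all_boot all_order all_algebra.
From mathcomp Require Import all_classical all_reals all_analysis.
From mathcomp Require Import ring lra.
Import Order.TTheory GRing.Theory Num.Theory.
Import numFieldNormedType.Exports.
Local Open Scope classical_set_scope.
Local Open Scope ring_scope.

(** Why the theorem is true.  Fix [pi] and a subgradient
    [g = \sum_i l_i grad J_{m_i}(pi)], a convex combination over worst-case
    models [m_i].  Each gradient is, up to the factor [(1 - gamma)^-1], the
    product [d_i(s) Q_i(s, a)] of an occupancy and an action value.  Under (A)
    all the [d_i] agree, under (B) all the [Q_i] agree, and in both cases the
    mean of the products is the product [w(s) Qbar(s, a)] of the means
    ([convex_mean_mul]).

    Let [pi'] be any competitor.  Since every [m_i] is worst for [pi],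
    [J_U(pi) - J_U(pi') <= \sum_i l_i (J_{m_i}(pi) - J_{m_i}(pi'))].  The
    performance difference identity ([performance_difference]) turns the right
    side into [(1 - gamma)^-1] times a mean of [d_i'(s) Q_i(s, a)] against
    [pi - pi'], where [d_i'] is the occupancy of [pi'] under [m_i].  (A) and (B)
    apply to [d_i'] as well, so that this is
    [(1 - gamma)^-1 \sum_s w'(s) \sum_a (pi - pi')(s, a) Qbar(s, a)].  Let
    [gain s >= 0] be the largest value of [\sum_a (pi - pi')(s, a) Qbar(s, a)],
    reached by the policy that is greedy for [Qbar], whatever the state.  As
    [w' <= 1], the gap is at most [(1 - gamma)^-1 \sum_s gain s]; as
    [w >= (1 - gamma) mu], the linearised gap of [g] towards the greedy policy
    is at least [\min mu \sum_s gain s].  Dividing gives the constant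
    ([gap_le_max_gap]).

    The extrema of the statement have to be attained.  The largest linearised
    gap of a given [g] is reached by a greedy policy ([max_gap_attained]).  Three
    others are minima, over a compact set, of a supremum of continuous functions
    ([sup_continuous_attains_min]): [- J] over models, [J_U] over policies, and
    the largest linearised gap over the subdifferential.  The last set is
    parametrised by a compact set thanks to Caratheodory's theorem
    ([caratheodory]), which bounds the length of the convex combinations.

    Trajectory sums are evaluated by value iteration ([truncated_totalE]); its
    limit is the unique solution of the Bellman equation, and convergence at the
    uniform rate [gamma ^ n] makes it continuous in the model and the policy
    ([policy_value_within_continuous]). *)

Set Implicit Arguments.
Unset Strict Implicit.
Unset Printing Implicit Defensive.

(** * Value iteration and the Bellman equation *)

Lemma cvg_sum (R : realType) (T : Type) (F : set_system T) (FF : Filter F)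
    (I : Type) (r : seq I) (p : pred I) (f : I -> T -> R) (l : I -> R) :
  (forall i, p i -> f i x @[x --> F] --> l i) ->
  \sum_(i <- r | p i) f i x @[x --> F] --> \sum_(i <- r | p i) l i.
Proof. by move=> fl; apply: cvg_big => //; exact: add_continuous. Qed.

Section Evaluation.
Variables (R : realType) (S A : finType) (gamma : R).
Implicit Types (P : Defs.kernel R S A) (pi f : S -> A -> R) (nu : S * A -> R).

Definition stochastic P := forall s a, is_distribution (P s a).

Definition pair_kernel P pi (x y : S * A) : R := P x.1 x.2 y.1 * pi y.1 y.2.

Definition next_mean P pi f s a : R :=
  \sum_s' P s a s' * \sum_a' pi s' a' * f s' a'.

(** The expected discounted total of [f] over the first [n + 1] pairs, as a
    function of the first pair. *)
Fixpoint value_iter P pi f n : S -> A -> R :=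
  if n is n'.+1 then
    fun s a => f s a + gamma * next_mean P pi (value_iter P pi f n') s a
  else f.

Lemma next_meanE P pi f s a :
  next_mean P pi f s a = \sum_y pair_kernel P pi (s, a) y * f y.1 y.2.
Proof.
rewrite /next_mean /pair_kernel -(pair_big xpredT xpredT
  (fun s' a' => P s a s' * pi s' a' * f s' a')) /=.
apply: eq_bigr => s' _; rewrite mulr_sumr.
by apply: eq_bigr => a' _; rewrite mulrA.
Qed.

Lemma next_mean_const P pi (c : R) s a : stochastic P -> policies pi ->
  next_mean P pi (fun _ _ => c) s a = c.
Proof.
move=> hP hpi; rewrite /next_mean.
under eq_bigr => s' _ do rewrite -mulr_suml (hpi s').2 mul1r.
by rewrite -mulr_suml (hP s a).2 mul1r.
Qed.

Lemma next_mean_state P pi (b : S -> R) s a : policies pi ->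
  next_mean P pi (fun s' _ => b s') s a = \sum_s' P s a s' * b s'.
Proof.
by move=> hpi; apply: eq_bigr => s' _; rewrite -mulr_suml (hpi s').2 mul1r.
Qed.

Lemma next_meanD P pi f g s a :
  next_mean P pi (fun s a => f s a + g s a) s a =
  next_mean P pi f s a + next_mean P pi g s a.
Proof.
rewrite /next_mean -big_split; apply: eq_bigr => s' _ /=.
rewrite -mulrDr -big_split; congr (_ * _).
by apply: eq_bigr => a' _; rewrite mulrDr.
Qed.

Lemma next_meanZ P pi f c s a :
  next_mean P pi (fun s a => c * f s a) s a = c * next_mean P pi f s a.
Proof.
rewrite /next_mean mulr_sumr; apply: eq_bigr => s' _.
rewrite mulrCA; congr (_ * _); rewrite mulr_sumr.
by apply: eq_bigr => a' _; rewrite mulrCA.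
Qed.

Lemma next_mean_le P pi f g s a : stochastic P -> policies pi ->
  (forall s a, f s a <= g s a) -> next_mean P pi f s a <= next_mean P pi g s a.
Proof.
move=> hP hpi fg; apply: ler_sum => s' _.
apply: ler_wpM2l; first exact: (hP s a).1.
by apply: ler_sum => a' _; apply: ler_wpM2l; [exact: (hpi s').1|].
Qed.

Definition ffcons n (x : S * A) (w : {ffun 'I_n -> S * A}) :
    {ffun 'I_n.+1 -> S * A} :=
  [ffun i => if unlift ord0 i is Some j then w j else x].

Lemma ffcons0 n x (w : {ffun 'I_n -> S * A}) : ffcons x w ord0 = x.
Proof. by rewrite ffunE unlift_none. Qed.

Lemma ffconsS n x (w : {ffun 'I_n -> S * A}) i : ffcons x w (lift ord0 i) = w i.
Proof. by rewrite ffunE liftK. Qed.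

Lemma sum_ffcons n (F : {ffun 'I_n.+1 -> S * A} -> R) :
  \sum_w F w = \sum_x \sum_w F (ffcons x w).
Proof.
rewrite pair_big /=.
rewrite (reindex (fun p : (S * A) * {ffun 'I_n -> S * A} => ffcons p.1 p.2)) //=.
exists (fun w => (w ord0, [ffun i => w (lift ord0 i)])).
  move=> [x w] _ /=; rewrite ffcons0; congr pair.
  by apply/ffunP => i; rewrite ffunE ffconsS.
move=> w _; apply/ffunP => i /=; rewrite ffunE.
by case: unliftP => [j ->|->] //; rewrite ffunE.
Qed.

(** Conditioning on the first pair [x] leaves a trajectory whose first pair has
    law [pair_kernel P pi x]. *)
Lemma traj_prob_cons P pi nu n x (w : {ffun 'I_n.+1 -> S * A}) :
  traj_prob P pi nu (ffcons x w) = nu x * traj_prob P pi (pair_kernel P pi x) w.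
Proof.
rewrite /traj_prob ffcons0; congr (_ * _); rewrite big_ord_recl; congr (_ * _).
  rewrite /= /pair_kernel ffconsS.
  have -> : widen_ord (leqnSn n.+1) ord0 = ord0 by apply/val_inj.
  by rewrite ffcons0.
apply: eq_bigr => h _.
have -> : widen_ord (leqnSn n.+1) (lift ord0 h) =
          lift ord0 (widen_ord (leqnSn n) h) by apply/val_inj.
by rewrite !ffconsS.
Qed.

Lemma traj_prob_mass P pi nu n : stochastic P -> policies pi ->
  \sum_(w : {ffun 'I_n.+1 -> S * A}) traj_prob P pi nu w = \sum_x nu x.
Proof.
move=> hP hpi; elim: n nu => [|n IH] nu; rewrite sum_ffcons.
  apply: eq_bigr => x _; rewrite (big_pred1 [ffun i : 'I_0 => x]); last first.
    by move=> w; symmetry; apply/eqP/ffunP => -[].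
  by rewrite /traj_prob big_ord0 mulr1 ffcons0.
apply: eq_bigr => x _.
under eq_bigr do rewrite traj_prob_cons.
rewrite -mulr_sumr IH -[RHS]mulr1; congr (_ * _); case: x => s a.
rewrite -[RHS](next_mean_const 1 s a hP hpi) next_meanE.
by under [in RHS]eq_bigr do rewrite mulr1.
Qed.

(** Splitting off the first pair turns a sum over trajectories of length [n + 2]
    into its immediate reward plus [gamma] times a sum over trajectories of length
    [n + 1], which is the recursion of value iteration. *)
Lemma truncated_totalE P pi nu f n : stochastic P -> policies pi ->
  truncated_total gamma P pi nu f n = \sum_x nu x * value_iter P pi f n x.1 x.2.
Proof.
move=> hP hpi; rewrite /truncated_total.
elim: n nu => [|n IH] nu; rewrite sum_ffcons.
  apply: eq_bigr => x _; rewrite (big_pred1 [ffun i : 'I_0 => x]); last first.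
    by move=> w; symmetry; apply/eqP/ffunP => -[].
  by rewrite /traj_prob big_ord0 mulr1 big_ord1 ffcons0 expr0 mul1r.
apply: eq_bigr => x _.
under eq_bigr => w _.
  rewrite traj_prob_cons big_ord_recl ffcons0 expr0 mul1r.
  under eq_bigr => h _ do rewrite ffconsS /= /bump /= add1n exprS -mulrA.
  rewrite -mulr_sumr -mulrA mulrDr.
  over.
rewrite -mulr_sumr; congr (_ * _); rewrite big_split /= -mulr_suml.
rewrite traj_prob_mass //; congr (_ + _).
  case: x => s a; rewrite -[RHS]mul1r; congr (_ * _).
  rewrite -[RHS](next_mean_const 1 s a hP hpi) next_meanE.
  by under [in RHS]eq_bigr do rewrite mulr1.
under eq_bigr do rewrite mulrCA.
by rewrite -mulr_sumr IH; case: x => s a; rewrite -next_meanE.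
Qed.

Lemma value_iterS P pi f n s a :
  value_iter P pi f n.+1 s a =
  f s a + gamma * next_mean P pi (value_iter P pi f n) s a.
Proof. by []. Qed.

Hypotheses (gamma_ge0 : 0 <= gamma) (gamma_lt1 : gamma < 1).

Lemma horizon_gt0 : 0 < 1 - gamma. Proof. by rewrite subr_gt0. Qed.

(** Averaging cannot increase the maximum of [`|f|], so multiplying by
    [gamma < 1] forces this maximum to be 0.  This is the uniqueness of solutions of
    the Bellman equation. *)
Lemma contractive_eq0 P pi f : stochastic P -> policies pi ->
  (forall s a, f s a = gamma * next_mean P pi f s a) -> forall s a, f s a = 0.
Proof.
move=> hP hpi hf s a.
have [[s0 a0] _ hmax] :=
  arg_maxP (fun x : S * A => `|f x.1 x.2|) (isT : xpredT (s, a)).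
have hle s' a' : `|f s' a'| <= `|f s0 a0| by exact: (hmax (s', a') isT).
have : `|f s0 a0| <= gamma * `|f s0 a0|.
  rewrite {1}hf normrM (ger0_norm gamma_ge0) ler_wpM2l// ler_norml.
  rewrite -(next_mean_const (- `|f s0 a0|) s0 a0 hP hpi).
  rewrite -{2}(next_mean_const (`|f s0 a0|) s0 a0 hP hpi).
  by apply/andP; split; apply: next_mean_le => // s' a';
    have := hle s' a'; rewrite ler_norml => /andP[].
have := normr_ge0 (f s0 a0); have := hle s a; have := normr_ge0 (f s a).
move=> h1 h2 h3 h4; apply/eqP; rewrite -normr_eq0; apply/eqP.
have {}h4 : `|f s0 a0| * (1 - gamma) <= 0 by lra.
move: h4; rewrite pmulr_lle0 ?horizon_gt0 // => h4; lra.
Qed.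

(** Value iteration and the fixed point obey the same affine recursion, which
    contracts the supremum distance by [gamma]. *)
Lemma value_iter_fixpoint_dist P pi f v (C : R) n s a :
  stochastic P -> policies pi ->
  (forall s a, v s a = f s a + gamma * next_mean P pi v s a) ->
  (forall s a, `|f s a - v s a| <= C) ->
  `|value_iter P pi f n s a - v s a| <= gamma ^+ n * C.
Proof.
move=> hP hpi hv hC; elim: n s a => [|n IH] s a; first by rewrite expr0 mul1r.
rewrite value_iterS hv opprD addrACA subrr add0r -mulrBr normrM ger0_norm //.
rewrite exprS -mulrA ler_wpM2l //.
have -> : next_mean P pi (value_iter P pi f n) s a - next_mean P pi v s a =
    next_mean P pi (fun s a => value_iter P pi f n s a + -1 * v s a) s a.
  by rewrite next_meanD next_meanZ mulN1r.
rewrite ler_norml.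
rewrite -(next_mean_const (- (gamma ^+ n * C)) s a hP hpi).
rewrite -{2}(next_mean_const (gamma ^+ n * C) s a hP hpi).
by apply/andP; split; apply: next_mean_le => // s' a';
    have := IH s' a'; rewrite mulN1r ler_norml => /andP[].
Qed.


(** A common range for the cost functions and for the indicators of states, the
    two kinds of reward whose totals occur in the gradient. *)
Definition unit_valued f := forall s a, 0 <= f s a <= 1.

Definition policy_value P pi f s a : R :=
  limn (fun n => value_iter P pi f n s a).

Section Value.
Variables (P : Defs.kernel R S A) (pi f : S -> A -> R).
Hypotheses (hP : stochastic P) (hpi : policies pi) (hf : unit_valued f).

Lemma value_iter_le n s a : value_iter P pi f n s a <= (1 - gamma)^-1.
Proof.
have hg := horizon_gt0.
elim: n s a => [|n IH] s a /=.
  have /andP[_ h] := hf s a; apply: le_trans h _.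
  by rewrite invf_ge1 ?hg // gerBl.
have /andP[_ h] := hf s a.
have := next_mean_le s a hP hpi IH; rewrite next_mean_const // => h'.
have -> : (1 - gamma)^-1 = 1 + gamma * (1 - gamma)^-1 by field; lra.
by rewrite lerD // ler_wpM2l.
Qed.

(** The reward is nonnegative, so a longer horizon collects more; with
    [value_iter_le] this gives convergence. *)
Lemma value_iter_nondecreasing s a :
  nondecreasing_seq (fun n => value_iter P pi f n s a).
Proof.
apply/nondecreasing_seqP => n; elim: n s a => [|n IH] s a.
  rewrite value_iterS lerDl mulr_ge0 // -(next_mean_const 0 s a hP hpi).
  by apply: next_mean_le => // s' a'; have /andP[] := hf s' a'.
by rewrite !value_iterS lerD2l ler_wpM2l // next_mean_le.
Qed.

Lemma value_iter_cvg s a :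
  (fun n => value_iter P pi f n s a) @ \oo --> policy_value P pi f s a.
Proof.
apply: nondecreasing_is_cvgn; first exact: value_iter_nondecreasing.
by exists (1 - gamma)^-1 => _ [n _ <-]; exact: value_iter_le.
Qed.

Lemma policy_value_ge s a : f s a <= policy_value P pi f s a.
Proof.
apply: (nondecreasing_cvgn_le (value_iter_nondecreasing s a) _ 0%N).
by apply/cvg_ex; exists (policy_value P pi f s a); exact: value_iter_cvg.
Qed.

Lemma policy_value_le s a : policy_value P pi f s a <= (1 - gamma)^-1.
Proof.
apply: limr_le.
  by apply/cvg_ex; exists (policy_value P pi f s a); exact: value_iter_cvg.
by near=> n; exact: value_iter_le.
Unshelve. all: end_near. Qed.

Lemma policy_value_fixpoint s a :
  policy_value P pi f s a =
  f s a + gamma * next_mean P pi (policy_value P pi f) s a.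
Proof.
have h1 : (fun n => value_iter P pi f n.+1 s a) @ \oo -->
    policy_value P pi f s a.
  rewrite (cvg_shiftS (fun n => value_iter P pi f n s a)).
  exact: value_iter_cvg.
rewrite -{1}(cvg_lim (@Rhausdorff R) h1); apply/cvg_lim => //.
apply: cvgD; first exact: cvg_cst.
apply: cvgMl_tmp; rewrite /next_mean.
apply: cvg_sum => s' _; apply: cvgMl_tmp.
apply: cvg_sum => a' _; apply: cvgMl_tmp; exact: value_iter_cvg.
Qed.

(** The rate depends on [gamma] only, hence is uniform over models and policies;
    continuity of the limit rests on this. *)
Lemma value_iter_dist n s a :
  `|value_iter P pi f n s a - policy_value P pi f s a| <=
  gamma ^+ n * (1 - gamma)^-1.
Proof.
apply: value_iter_fixpoint_dist => // {}s {}a.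
  exact: policy_value_fixpoint.
have := policy_value_ge s a; have := policy_value_le s a.
have /andP[h0 h1] := hf s a.
rewrite ler_norml => h2 h3; lra.
Qed.

Lemma discounted_totalE nu :
  discounted_total gamma P pi nu f = \sum_x nu x * policy_value P pi f x.1 x.2.
Proof.
apply/cvg_lim => //.
under eq_cvg do rewrite truncated_totalE //.
apply: cvg_sum => x _; apply: cvgMl_tmp; exact: value_iter_cvg.
Qed.

End Value.

Section Costs.
Variable mu : S -> R.
Implicit Types m : model R S A.

Definition visit (s : S) : S -> A -> R := fun s' _ => (s' == s)%:R.

Lemma visit_unit s : unit_valued (visit s).
Proof. by move=> s' a; rewrite /visit; case: eqP; rewrite ?lexx ?ler01. Qed.

Lemma sum_init_law pi (F : S * A -> R) :
  \sum_x init_law mu pi x * F x = \sum_s mu s * \sum_a pi s a * F (s, a).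
Proof.
transitivity (\sum_s \sum_a init_law mu pi (s, a) * F (s, a)).
  by rewrite pair_big /=; apply: eq_bigr => -[].
apply: eq_bigr => s _; rewrite mulr_sumr.
by apply: eq_bigr => a _; rewrite mulrA.
Qed.

Lemma total_costE m pi : is_model m -> policies pi ->
  total_cost mu gamma m pi =
  \sum_s mu s * \sum_a pi s a * policy_value m.2 pi m.1 s a.
Proof.
move=> [hc hP] hpi.
by rewrite /total_cost discounted_totalE // sum_init_law.
Qed.

Lemma action_valueE m pi s a : is_model m -> policies pi ->
  action_value gamma m pi s a = policy_value m.2 pi m.1 s a.
Proof.
move=> [hc hP] hpi; rewrite /action_value discounted_totalE //.
rewrite (bigD1 (s, a)) //= eqxx mul1r big1 ?addr0 // => x /negbTE ->.
by rewrite mul0r.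
Qed.

Lemma occupancyE P pi s : stochastic P -> policies pi ->
  occupancy mu gamma P pi s =
  (1 - gamma) *
  \sum_s' mu s' * \sum_a pi s' a * policy_value P pi (visit s) s' a.
Proof.
move=> hP hpi; rewrite /occupancy discounted_totalE //; last exact: visit_unit.
by rewrite sum_init_law.
Qed.

Hypothesis mu_distr : is_distribution mu.

(** The time-0 visit to [s] alone contributes [mu s]. *)
Lemma occupancy_ge P pi s : stochastic P -> policies pi ->
  (1 - gamma) * mu s <= occupancy mu gamma P pi s.
Proof.
move=> hP hpi; rewrite occupancyE // ler_wpM2l ?(ltW horizon_gt0) //.
rewrite (bigD1 s) //= -[leLHS]addr0; apply: lerD.
  rewrite -{1}[mu s]mulr1 ler_wpM2l ?mu_distr.1 // -(hpi s).2.
  apply: ler_sum => a _; rewrite -{1}[pi s a]mulr1 ler_wpM2l ?(hpi s).1 //.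
  apply: le_trans (policy_value_ge hP hpi (visit_unit s) s a).
  by rewrite /visit eqxx.
apply: sumr_ge0 => s' _; apply: mulr_ge0; first exact: mu_distr.1.
apply: sumr_ge0 => a _; apply: mulr_ge0; first exact: (hpi s').1.
apply: le_trans (policy_value_ge hP hpi (visit_unit s) s' a).
by have /andP[] := visit_unit s s' a.
Qed.

Lemma occupancy_le1 P pi s : stochastic P -> policies pi ->
  occupancy mu gamma P pi s <= 1.
Proof.
move=> hP hpi; rewrite occupancyE // -ler_pdivlMl ?horizon_gt0 // mulr1.
rewrite -[leRHS]mul1r -[X in _ <= X * _]mu_distr.2 mulr_suml.
apply: ler_sum => s' _.
rewrite ler_wpM2l ?mu_distr.1 // -[leRHS]mul1r.
rewrite -[X in _ <= X * _](hpi s').2 mulr_suml.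
apply: ler_sum => a _; rewrite ler_wpM2l ?(hpi s').1 //.
exact: (policy_value_le hP hpi (visit_unit s)).
Qed.

(** With [Q] and [Q'] the action values of [pi] and [pi'], and [b s] the mean of
    [Q s] against [pi - pi'], the function [Q - Q' + b] solves the Bellman equation
    of [pi'] for the state reward [b]. It is therefore the [b]-weighted sum of the
    expected discounted numbers of visits under [pi']. *)
Lemma performance_difference m pi pi' :
  is_model m -> policies pi -> policies pi' ->
  total_cost mu gamma m pi - total_cost mu gamma m pi' =
  (1 - gamma)^-1 * \sum_s occupancy mu gamma m.2 pi' s *
    \sum_a (pi s a - pi' s a) * action_value gamma m pi s a.
Proof.
move=> hm hpi hpi'; have [hc hP] := hm.
pose Q := policy_value m.2 pi m.1; pose Q' := policy_value m.2 pi' m.1.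
pose b s := \sum_a (pi s a - pi' s a) * Q s a.
pose V s a := \sum_s' b s' * policy_value m.2 pi' (visit s') s a.
(* [V] is the total of the reward [b], assembled linearly from visit counts. *)
have fixV s a : V s a = b s + gamma * next_mean m.2 pi' V s a.
  have -> : next_mean m.2 pi' V s a =
      \sum_s' b s' * next_mean m.2 pi' (policy_value m.2 pi' (visit s')) s a.
    rewrite /next_mean /V; under [RHS]eq_bigr do rewrite mulr_sumr.
    rewrite [RHS]exchange_big /=; apply: eq_bigr => t _.
    under eq_bigr do rewrite mulr_sumr.
    rewrite exchange_big /= mulr_sumr; apply: eq_bigr => u _.
    rewrite mulrCA; congr (_ * _); rewrite mulr_sumr.
    by apply: eq_bigr => c _; rewrite mulrCA.
  rewrite /V; under eq_bigr => s' _ do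
    rewrite (policy_value_fixpoint hP hpi' (visit_unit s')) mulrDr.
  rewrite big_split /=; congr (_ + _).
    rewrite (bigD1 s) //= /visit eqxx mulr1 big1 ?addr0 // => s' /negbTE.
    by rewrite eq_sym => ->; rewrite mulr0.
  rewrite mulr_sumr; apply: eq_bigr => s' _; exact: mulrCA.
have QV s a : Q s a - Q' s a + b s = V s a.
  have h : forall s a, (Q s a + -1 * Q' s a) + (b s + -1 * V s a) = 0.
    apply: (contractive_eq0 hP hpi') => t c.
    rewrite next_meanD !next_meanD !next_meanZ fixV.
    rewrite /Q (policy_value_fixpoint hP hpi hc) -/Q.
    rewrite /Q' (policy_value_fixpoint hP hpi' hc) -/Q' next_mean_state //.
    have -> : next_mean m.2 pi Q t c =
        next_mean m.2 pi' Q t c + \sum_s' m.2 t c s' * b s'.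
      rewrite /next_mean -big_split; apply: eq_bigr => s' _ /=.
      rewrite -mulrDr -big_split; congr (_ * _); apply: eq_bigr => a' _ /=.
      by rewrite mulrBl addrC subrK.
    ring.
  by have := h s a; lra.
rewrite !total_costE // -sumrB.
under [in RHS]eq_bigr => s _ do under eq_bigr do rewrite action_valueE //.
have -> : \sum_s occupancy mu gamma m.2 pi' s * b s =
   (1 - gamma) * \sum_s mu s * \sum_a pi' s a * V s a.
  under eq_bigr => s _ do rewrite occupancyE // -mulrA mulr_suml.
  rewrite -mulr_sumr exchange_big /=; congr (_ * _); apply: eq_bigr => t _.
  under eq_bigr => s _ do rewrite -mulrA mulr_suml.
  rewrite -mulr_sumr exchange_big /=; congr (_ * _); apply: eq_bigr => c _.
  under eq_bigr => s _ do rewrite -mulrA.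
  rewrite -mulr_sumr; congr (_ * _).
  by apply: eq_bigr => s _; rewrite mulrC.
rewrite mulrA mulVf ?mul1r; last by rewrite gt_eqF ?horizon_gt0.
apply: eq_bigr => s _; rewrite -mulrBr; congr (_ * _).
have -> : \sum_a pi' s a * V s a =
    \sum_a pi' s a * (Q s a - Q' s a) + b s.
  under eq_bigr do rewrite -QV mulrDr.
  by rewrite big_split /= -[X in _ + X]mulr_suml (hpi' s).2 mul1r.
rewrite /b -big_split -sumrB; apply: eq_bigr => c _ /=.
rewrite /Q /Q'; ring.
Qed.

End Costs.

End Evaluation.
Arguments visit {R S A} s.

(** * Attained extrema on compact sets *)

Section Compactness.
Variables (R : realType) (T : topologicalType).
Implicit Types (K E : set T).

(** Sublevel sets of a function continuous on [K] are closed relative to [K]. *)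
Lemma closure_within_le K E (f : T -> R) x t :
  {within K, continuous f} -> K x -> E `<=` K -> closure E x ->
  (forall y, E y -> f y <= t) -> f x <= t.
Proof.
move=> /subspace_continuousP fc Kx EK Ex hE; rewrite leNgt; apply/negP => tfx.
have : \forall y \near x, K y -> t < f y.
  by have /(_ _ (lt_nbhsr tfx)) := fc _ Kx.
by move=> /Ex [y [Ey /(_ (EK _ Ey))]]; rewrite ltNge hE.
Qed.

Lemma within_continuous_ext K (f g : T -> R) :
  (forall x, K x -> f x = g x) ->
  {within K, continuous f} -> {within K, continuous g}.
Proof.
by move=> fg; apply: subspace_eq_continuous => x /set_mem; exact: fg.
Qed.

Lemma compact_sublevel K (I : Type) (D : set I) (G : I -> T -> R) (t : I -> R) :
  compact K -> (forall i, D i -> {within K, continuous (G i)}) ->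
  compact [set x | K x /\ forall i, D i -> G i x <= t i].
Proof.
move=> cK cG; set E := (X in compact X) => F FF FE.
have [x [Kx clx]] := cK F FF (filterS (fun x => @proj1 _ _) FE).
exists x; split => //; split => // i Di.
apply: (closure_within_le (cG i Di) Kx (E := E)).
- by move=> y [].
- by move=> B nB; apply: clx.
- by move=> y [_]; exact.
Qed.

(** The sublevel sets of [f] at the values [f y] are nested, so that they generate
    a filter on [K]. A cluster point of it lies in all of them, since each is an
    intersection of relatively closed sublevel sets of the [G i]. *)
Lemma sup_continuous_attains_min K (I : Type) (D : set I) (G : I -> T -> R)
    (f : T -> R) :
  compact K -> K !=set0 -> (forall i, D i -> {within K, continuous (G i)}) ->
  (forall x t, K x -> (f x <= t <-> forall i, D i -> G i x <= t)) ->
  exists2 x, K x & forall y, K y -> f x <= f y.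
Proof.
move=> cK [x0 Kx0] cG fG.
pose B y := K `&` [set x | f x <= f y].
have FB : Filter (filter_from K B).
  apply: filter_from_filter; first by exists x0.
  move=> y z Ky Kz; have [yz|/ltW zy] := leP (f y) (f z).
    by exists y => // x [Kx xy]; split; split => //; exact: le_trans xy yz.
  by exists z => // x [Kx xz]; split; split => //; exact: le_trans xz zy.
have PB : ProperFilter (filter_from K B).
  by apply: filter_from_proper => y Ky; exists y; split => //=.
have [x [Kx clx]] : K `&` cluster (filter_from K B) !=set0.
  by apply: cK; exists x0 => // y [].
exists x => // y Ky; apply/(fG _ _ Kx) => i Di.
apply: (closure_within_le (cG i Di) Kx (E := B y)); first by move=> z [].
  by move=> W nW; apply: clx => //; exists y.
by move=> z [Kz zy]; exact: (fG _ _ Kz).1 zy i Di.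
Qed.

End Compactness.

Lemma continuous_coord (I : eqType) (X : topologicalType) (i : I) :
  continuous (fun f : I -> X => f i).
Proof. exact: (@proj_continuous I (fun=> X) i). Qed.

(** A relatively closed part of the cube, which is compact by Tychonoff. *)
Lemma compact_simplex (R : realType) (T : finType) :
  compact [set p : T -> R | is_distribution p].
Proof.
pose K := [set p : T -> R | forall i, `[0, 1]%classic (p i)].
have cK : compact K.
  apply: (@tychonoff T (fun=> R) (fun=> `[0, 1]%classic)) => i.
  exact: segment_compact.
(* The two signs express the equation [\sum_i p i = 1] by inequalities. *)
pose G (b : bool) (p : T -> R) : R := (-1) ^+ b * \sum_i p i.
have cG b : setT b -> {within K, continuous (G b)}.
  move=> _; apply: continuous_subspaceT => p; rewrite /continuous_at /G.
  apply: (@cvgMl_tmp R _ (nbhs p) _ (fun q => \sum_i q i)).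
  by apply: cvg_sum => i _; exact: continuous_coord.
have := compact_sublevel (t := fun b : bool => (-1) ^+ b) cK cG.
congr compact; apply/seteqP; split => p /=.
  move=> [Kp h]; split.
    by move=> i; have := Kp i; rewrite /= in_itv /= => /andP[].
  have := h true I; have := h false I; rewrite /G /= expr0 expr1 => h1 h2; lra.
move=> [p0 p1]; split.
  move=> i; rewrite /= in_itv /= p0 /= -p1 (bigD1 i) //= lerDl.
  by apply: sumr_ge0 => j _; exact: p0.
by move=> b _; rewrite /G p1 mulr1.
Qed.

Section Extrema.
Variable R : realType.
Implicit Type X : set R.

Lemma setmaxE X x : X x -> ubound X x -> setmax X = x.
Proof.
move=> Xx ux; apply: xget_unique; first by split.
by move=> y [Xy uy]; apply/eqP; rewrite eq_le ux // uy.
Qed.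

Lemma setminE X x : X x -> lbound X x -> setmin X = x.
Proof.
move=> Xx ux; apply: xget_unique; first by split.
by move=> y [Xy uy]; apply/eqP; rewrite eq_le ux // uy.
Qed.

End Extrema.

(** * Continuity of total costs and gradients *)

Section ValueContinuity.
Variables (R : realType) (S A : finType) (gamma : R).
Variables (T : topologicalType).

Lemma value_iter_continuous (P_ : T -> Defs.kernel R S A)
    (pi_ f_ : T -> S -> A -> R) n s a :
  (forall s a s', continuous (fun t => P_ t s a s')) ->
  (forall s a, continuous (fun t => pi_ t s a)) ->
  (forall s a, continuous (fun t => f_ t s a)) ->
  continuous (fun t => value_iter gamma (P_ t) (pi_ t) (f_ t) n s a).
Proof.
move=> cP cpi cf; elim: n s a => [|n IH] s a /=; first exact: cf.
move=> t; apply: cvgD; first exact: cf.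
apply: cvgMl_tmp; apply: cvg_sum => s' _; apply: cvgM; first exact: cP.
by apply: cvg_sum => a' _; apply: cvgM; [exact: cpi|exact: IH].
Qed.

Hypotheses (gamma_ge0 : 0 <= gamma) (gamma_lt1 : gamma < 1).

(** Value iterates are polynomial in the model and the policy, and converge
    uniformly: the usual three-term estimate applies. *)
Lemma policy_value_within_continuous (K : set T) (P_ : T -> Defs.kernel R S A)
    (pi_ f_ : T -> S -> A -> R) s a :
  (forall s a s', continuous (fun t => P_ t s a s')) ->
  (forall s a, continuous (fun t => pi_ t s a)) ->
  (forall s a, continuous (fun t => f_ t s a)) ->
  (forall t, K t -> stochastic (P_ t)) ->
  (forall t, K t -> policies (pi_ t)) ->
  (forall t, K t -> unit_valued (f_ t)) ->
  {within K,
    continuous (fun t => policy_value gamma (P_ t) (pi_ t) (f_ t) s a)}.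
Proof.
move=> cP cpi cf hP hpi hf; apply/subspace_continuousP => x Kx.
apply/cvgrPdist_lt => e e0.
have e3 : 0 < e / 3 by rewrite divr_gt0.
have : (fun n => gamma ^+ n * (1 - gamma)^-1) @ \oo --> (0 : R).
  rewrite -[X in _ --> X](mul0r (1 - gamma)^-1); apply: cvgMr_tmp.
  by apply: cvg_expr; rewrite ger0_norm.
move=> /cvgrPdist_lt /(_ _ e3) [n _ /(_ n (leqnn n))] /=.
rewrite sub0r normrN ger0_norm; last first.
  by rewrite mulr_ge0 ?exprn_ge0 ?invr_ge0 ?subr_ge0 ?(ltW gamma_lt1).
move=> hn.
have dist y : K y ->
    `|value_iter gamma (P_ y) (pi_ y) (f_ y) n s a -
      policy_value gamma (P_ y) (pi_ y) (f_ y) s a| < e / 3.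
  move=> Ky; apply: le_lt_trans hn; apply: value_iter_dist => //.
  - exact: hP.
  - exact: hpi.
  - exact: hf.
have /cvgrPdist_lt/(_ _ e3) near_n :=
  @value_iter_continuous P_ pi_ f_ n s a cP cpi cf x.
near=> y => /=.
have Ky : K y by near: y; exact: withinT.
have h1 := dist _ Kx; have h2 := dist _ Ky.
have h3 : `|value_iter gamma (P_ x) (pi_ x) (f_ x) n s a -
            value_iter gamma (P_ y) (pi_ y) (f_ y) n s a| < e / 3.
  by near: y; apply: cvg_within; exact: near_n.
move: h1 h2 h3; rewrite !ltr_norml => /andP[? ?] /andP[? ?] /andP[? ?].
by rewrite /from_subspace; apply/andP; split; lra.
Unshelve. all: end_near. Qed.

Section Models.
Variables (K : set T) (m_ : T -> model R S A) (pi_ : T -> S -> A -> R).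
Hypotheses (cont_cost : forall s a, continuous (fun t => (m_ t).1 s a))
  (cont_kernel : forall s a s', continuous (fun t => (m_ t).2 s a s'))
  (cont_policy : forall s a, continuous (fun t => pi_ t s a))
  (K_model : forall t, K t -> is_model (m_ t))
  (K_policy : forall t, K t -> policies (pi_ t)).
Variable mu : S -> R.

Let within_policy s a : {within K, continuous (fun t => pi_ t s a)}.
Proof. exact: continuous_subspaceT. Qed.

Lemma total_cost_within_continuous :
  {within K, continuous (fun t => total_cost mu gamma (m_ t) (pi_ t))}.
Proof.
apply: (within_continuous_ext (f := fun t =>
  \sum_s mu s * \sum_a pi_ t s a *
    policy_value gamma (m_ t).2 (pi_ t) (m_ t).1 s a)).
  by move=> t Kt; rewrite total_costE //; [exact: K_model|exact: K_policy].
move=> t; apply: cvg_sum => s _; apply: cvgMl_tmp; apply: cvg_sum => a _.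
apply: cvgM; first exact: within_policy.
apply: policy_value_within_continuous => // u Ku;
  by have [] := K_model Ku.
Qed.

Lemma grad_within_continuous s a :
  {within K, continuous (fun t => grad_total_cost mu gamma (m_ t) (pi_ t) s a)}.
Proof.
have K_kernel u : K u -> stochastic (m_ u).2 by move=> /K_model[].
apply: (within_continuous_ext (f := fun t => (1 - gamma)^-1 * ((1 - gamma) *
  \sum_s' mu s' * \sum_a' pi_ t s' a' *
     policy_value gamma (m_ t).2 (pi_ t) (visit s) s' a') *
  policy_value gamma (m_ t).2 (pi_ t) (m_ t).1 s a)).
  move=> t Kt; have hm := K_model Kt; have hpi := K_policy Kt.
  by rewrite /grad_total_cost action_valueE // occupancyE //; exact: K_kernel.
move=> t; apply: cvgM; last first.
  apply: policy_value_within_continuous => // u Ku;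
    by have [] := K_model Ku.
do 2 apply: cvgMl_tmp.
apply: cvg_sum => s' _; apply: cvgMl_tmp; apply: cvg_sum => a' _.
apply: cvgM; first exact: within_policy.
apply: policy_value_within_continuous => //.
- by move=> ? ? ?; exact: cvg_cst.
- by move=> u Ku; exact: visit_unit.
Qed.

End Models.
End ValueContinuity.

Section Coordinate.
Variables (R : realType) (S A : finType).

Lemma continuous_coord2 (X : topologicalType) s a :
  continuous (fun g : S -> A -> X => g s a).
Proof.
move=> g; apply: (continuous_comp (f := fun g : S -> A -> X => g s)
  (g := fun h : A -> X => h a)); exact: continuous_coord.
Qed.

Lemma continuous_cost s a : continuous (fun m : model R S A => m.1 s a).
Proof.
move=> m; apply: (continuous_comp (f := fst)
  (g := fun g : S -> A -> R => g s a)); first exact: cvg_fst.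
exact: continuous_coord2.
Qed.

Lemma continuous_kernel s a s' :
  continuous (fun m : model R S A => m.2 s a s').
Proof.
move=> m; apply: (continuous_comp (f := snd)
  (g := fun g : S -> A -> S -> R => g s a s')); first exact: cvg_snd.
move=> P; apply: (continuous_comp (f := fun g : S -> A -> S -> R => g s a)
  (g := fun h : S -> R => h s')); first exact: continuous_coord2.
exact: continuous_coord.
Qed.

End Coordinate.

(** * Convex hulls in finite dimension *)

Section Caratheodory.
Variables (R : realType) (V : lmodType R) (X : set V).

Definition convex_comb (n : nat) (x : V) : Prop :=
  exists (l : 'I_n -> R) (v : 'I_n -> V),
    [/\ forall i, 0 <= l i, \sum_i l i = 1, forall i, X (v i)
      & x = \sum_i l i *: v i].

Lemma convex_comb_widen n x : convex_comb n x -> convex_comb n.+1 x.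
Proof.
case: n => [|n] [l [v [l0 l1 Xv ->]]].
  by move/eqP: l1; rewrite big_ord0 eq_sym oner_eq0.
exists (fun i => if unlift ord0 i is Some j then l j else 0).
exists (fun i => if unlift ord0 i is Some j then v j else v ord0).
split.
- by move=> i; case: unlift.
- by rewrite big_ord_recl unlift_none add0r -[RHS]l1;
    apply: eq_bigr => j _; rewrite liftK.
- by move=> i; case: unlift.
- by rewrite [RHS]big_ord_recl unlift_none scale0r add0r;
    apply: eq_bigr => j _; rewrite liftK.
Qed.

Variables (d : nat) (e : {linear V -> 'rV[R]_d}).
Hypothesis e_inj : injective e.

(** More than [d + 1] rows [(e (v i), 1)] in dimension [d + 1] are linearly
    dependent; the last column says that the coefficients sum to 0, so one of them
    is positive. *)
Lemma affine_dependence n (v : 'I_n -> V) : (d.+1 < n)%N ->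
  exists u : 'I_n -> R,
    [/\ \sum_i u i *: v i = 0, \sum_i u i = 0 & exists i, 0 < u i].
Proof.
move=> dn.
pose M := \matrix_i row_mx (e (v i)) (1 : 'rV_1).
have /rowV0Pn[u /sub_kermxP uM0 u0] : kermx M != 0.
  rewrite -mxrank_eq0 mxrank_ker subn_eq0 -ltnNge.
  by apply: leq_ltn_trans (rank_leq_col M) _; rewrite addn1.
have col k : \sum_i u 0 i * M i k = 0.
  by move/matrixP: uM0 => /(_ 0 k); rewrite !mxE.
have sum0 : \sum_i u 0 i = 0.
  rewrite -[RHS](col (rshift d ord0)); apply: eq_bigr => i _.
  by rewrite mxE row_mxEr mxE eqxx mulr1.
exists (u 0); split => //.
  apply: e_inj; rewrite linear0 linear_sum; apply/rowP => k.
  rewrite summxE mxE -[RHS](col (lshift 1 k)); apply: eq_bigr => i _.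
  by rewrite linearZ /= [M _ _]mxE row_mxEl mxE.
apply: contrapT => hneg; case/negP: u0; apply/eqP/rowP => i.
have neg k : 0 <= - u 0 k.
  by rewrite oppr_ge0 leNgt; apply/negP => uk; apply: hneg; exists k.
have : \sum_i - u 0 i = 0 by rewrite sumrN sum0 oppr0.
move=> /(psumr_eq0P (fun k _ => neg k)) /(_ i isT) /eqP.
by rewrite oppr_eq0 => /eqP ->; rewrite mxE.
Qed.

(** Moving the weights along an affine dependence, as far as they stay
    nonnegative, keeps the point and the total weight and makes one weight vanish. *)
Lemma convex_comb_shrink n x : (d < n)%N -> convex_comb n.+1 x ->
  convex_comb n x.
Proof.
move=> dn [l [v [l0 l1 Xv ->]]].
have [u [uv0 us0 [i0 ui0]]] := affine_dependence v (n := n.+1) dn.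
(* The ratio test: the first weight to vanish when moving along [- u]. *)
have [j uj jmin] := arg_minP (fun i => l i / u i) (P := fun i => 0 < u i) ui0.
pose w i := l i - l j / u j * u i.
have w0 i : 0 <= w i.
  rewrite subr_ge0; have [ui|ui] := ltP 0 (u i).
    by rewrite -ler_pdivlMr // jmin.
  apply: le_trans (l0 i); rewrite mulr_ge0_le0 //.
  by rewrite divr_ge0 // ltW.
have wj : w j = 0 by rewrite /w divfK ?subrr // gt_eqF.
exists (fun k => w (lift j k)), (fun k => v (lift j k)); split => //.
  have <- : \sum_i w i = 1 by rewrite sumrB l1 -mulr_sumr us0 mulr0 subr0.
  by rewrite [RHS](bigD1_ord j) //= wj add0r.
transitivity (\sum_i w i *: v i); last first.
  by rewrite (bigD1_ord j) //= wj scale0r add0r.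
under [RHS]eq_bigr do rewrite scalerBl -scalerA.
by rewrite sumrB -scaler_sumr uv0 scaler0 subr0.
Qed.

Lemma caratheodory x : convex_hull X x -> convex_comb d.+1 x.
Proof.
move=> [n]; rewrite -/(convex_comb n x).
have [nd|dn] := leqP n d.+1.
  rewrite -(subnKC nd); elim: (_ - _)%N => [|k IH]; first by rewrite addn0.
  by move=> /IH; rewrite addnS => /convex_comb_widen.
rewrite -(subnKC (ltnW dn)); elim: (_ - _)%N => [|k IH]; first by rewrite addn0.
rewrite addnS => /convex_comb_shrink h; apply/IH/h.
by rewrite addSn ltnS leq_addr.
Qed.

End Caratheodory.

Section Coordinates.
Variables (R : realType) (S A : finType).

(** Realises functions of state-action pairs as row vectors, to supply the finite
    dimension that Caratheodory's theorem asks for. *)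
Definition coords (g : S -> A -> R) : 'rV[R]_#|{: S * A}| :=
  \row_k g (enum_val k).1 (enum_val k).2.

Lemma coords_linear : linear coords.
Proof. by move=> c f g; apply/rowP => k; rewrite !mxE. Qed.

HB.instance Definition _ :=
  GRing.isLinear.Build R (S -> A -> R) 'rV[R]_#|{: S * A}| _
    coords coords_linear.

Lemma coords_inj : injective coords.
Proof.
move=> f g /rowP fg; apply/funext => s; apply/funext => a.
by have := fg (enum_rank (s, a)); rewrite !mxE enum_rankK.
Qed.

End Coordinates.

(** The only place where (A) or (B) acts: the mean of a product is the product of
    the means as soon as one factor is constant. *)
Lemma convex_mean_mul (R : realType) n (l d q : 'I_n -> R) :
  \sum_i l i = 1 ->
  (exists c, forall i, d i = c) \/ (exists c, forall i, q i = c) ->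
  \sum_i l i * (d i * q i) = (\sum_i l i * d i) * \sum_i l i * q i.
Proof.
move=> l1 [[c dc]|[c qc]].
  under eq_bigr do rewrite dc mulrCA; rewrite -mulr_sumr.
  by under [in RHS]eq_bigr do rewrite dc; rewrite -mulr_suml l1 mul1r.
under eq_bigr do rewrite qc mulrA; rewrite -mulr_suml.
by under [X in _ = _ * X]eq_bigr do rewrite qc; rewrite -mulr_suml l1 mul1r.
Qed.

(** * Greedy policies and linearised gaps *)

Section Policies.
Variables (R : realType) (S A : finType).
Implicit Types pi g : S -> A -> R.

Lemma compact_policies : compact (@policies R S A).
Proof.
apply: (@tychonoff S (fun=> A -> R) (fun=> [set p | is_distribution p])) => s.
exact: compact_simplex.
Qed.

(** One policy is optimal at all states at once, because the choices made
    at different states are unrelated. *)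
Lemma exists_greedy (a0 : A) g : exists2 pi, policies pi &
  forall pi', policies pi' -> forall s,
    \sum_a pi s a * g s a <= \sum_a pi' s a * g s a.
Proof.
pose am s := [arg min_(a < a0) g s a]%O.
exists (fun s a => (a == am s)%:R).
  move=> s; split; first by move=> a; case: eqP.
  by rewrite (bigD1 (am s)) //= eqxx big1 ?addr0 // => a /negbTE ->.
move=> pi' hpi' s; rewrite (bigD1 (am s)) //= eqxx mul1r big1 ?addr0; last first.
  by move=> a /negbTE ->; rewrite mul0r.
rewrite -[leLHS]mul1r -(hpi' s).2 mulr_suml; apply: ler_sum => a _.
rewrite ler_wpM2l ?(hpi' s).1 // /am.
by case: arg_minP => // b _ /(_ a isT).
Qed.

Definition lin_gap pi pi' g : R := \sum_s \sum_a (pi s a - pi' s a) * g s a.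

Definition max_gap pi g : R :=
  setmax [set lin_gap pi pi' g | pi' in @policies R S A].

Lemma max_gap_attained (a0 : A) pi g :
  exists2 pi', policies pi' & max_gap pi g = lin_gap pi pi' g /\
    forall pi'', policies pi'' -> lin_gap pi pi'' g <= lin_gap pi pi' g.
Proof.
have [p hp greedy] := exists_greedy a0 g.
have best pi'' : policies pi'' -> lin_gap pi pi'' g <= lin_gap pi p g.
  move=> hpi''; apply: ler_sum => s _.
  under eq_bigr do rewrite mulrBl; under [leRHS]eq_bigr do rewrite mulrBl.
  by rewrite !sumrB lerD2l lerN2 greedy.
exists p => //; split=> //; apply: setmaxE; first by exists p.
by move=> _ [pi'' h <-]; exact: best.
Qed.

(** Displays [max_gap pi] as a supremum of linear functions of [g], the form in
    which its minimum over the subdifferential is obtained. *)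
Lemma max_gap_leP (a0 : A) pi g t :
  max_gap pi g <= t <-> forall pi', policies pi' -> lin_gap pi pi' g <= t.
Proof.
have [p hp [-> best]] := max_gap_attained a0 pi g.
by split=> [h pi' /best|/(_ _ hp)//] => h'; exact: le_trans h' h.
Qed.

Lemma lin_gap_sum pi pi' n (l : 'I_n -> R) (g : 'I_n -> S -> A -> R) :
  lin_gap pi pi' (\sum_i l i *: g i) = \sum_i l i * lin_gap pi pi' (g i).
Proof.
rewrite /lin_gap; under [RHS]eq_bigr do rewrite mulr_sumr.
rewrite [RHS]exchange_big /=; apply: eq_bigr => s _.
under [RHS]eq_bigr do rewrite mulr_sumr.
rewrite [RHS]exchange_big /=; apply: eq_bigr => a _.
rewrite fct_sumE fct_sumE mulr_sumr. apply: eq_bigr => i _.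
by rewrite mulrCA.
Qed.

End Policies.

(** * Robust costs *)

Section Robust.
Variables (R : realType) (S A : finType) (mu : S -> R) (gamma : R).
Variable U : set (model R S A).
Hypotheses (mu_distr : is_distribution mu)
  (gamma_ge0 : 0 <= gamma) (gamma_lt1 : gamma < 1)
  (U_models : forall m, U m -> is_model m)
  (U_nonempty : U !=set0) (U_compact : compact U).

Let J : model R S A -> (S -> A -> R) -> R := total_cost mu gamma.
Let worst := worst_models mu gamma U.

Lemma J_model_continuous pi : policies pi -> {within U, continuous (J ^~ pi)}.
Proof.
move=> hpi; apply: (total_cost_within_continuous gamma_ge0 gamma_lt1
  (m_ := id) (pi_ := fun=> pi)) => //.
- exact: continuous_cost.
- exact: continuous_kernel.
- by move=> s a; exact: cst_continuous.
Qed.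

Lemma J_policy_continuous m : is_model m ->
  {within @policies R S A, continuous (J m)}.
Proof.
move=> hm; apply: (total_cost_within_continuous gamma_ge0 gamma_lt1
  (m_ := fun=> m) (pi_ := id)) => //.
- by move=> s a; exact: cst_continuous.
- by move=> s a s'; exact: cst_continuous.
- exact: continuous_coord2.
Qed.

(** [U] is compact and the cost is continuous in the model. *)
Lemma worst_nonempty pi : policies pi -> worst pi !=set0.
Proof.
move=> hpi.
have [m Um hm] : exists2 m, U m & forall m', U m' -> - J m pi <= - J m' pi.
  apply: (sup_continuous_attains_min (D := [set: unit])
    (G := fun _ m => - J m pi)) => //.
    by move=> _ _ m; apply: cvgN; exact: J_model_continuous.
  by move=> m t _; split=> [h _ _|/(_ tt I)].
by exists m; split => // m' /hm; rewrite lerN2.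
Qed.

Lemma robust_costE pi m : worst pi m -> robust_cost mu gamma U pi = J m pi.
Proof.
move=> [Um hm]; apply: setmaxE; first by exists m.
by move=> _ [m' Um' <-]; exact: hm.
Qed.

Lemma robust_cost_leP pi t : policies pi ->
  robust_cost mu gamma U pi <= t <-> forall m, U m -> J m pi <= t.
Proof.
move=> hpi; have [m wm] := worst_nonempty hpi; rewrite (robust_costE wm).
split; last by apply; have [] := wm.
by move=> h m' Um'; apply: le_trans h; exact: wm.2.
Qed.

(** [robust_cost_leP] displays the robust cost as a supremum of functions that
    are continuous in the policy. *)
Lemma robust_cost_attains_min (pi0 : S -> A -> R) : policies pi0 ->
  exists2 pi, policies pi & forall pi', policies pi' ->
    robust_cost mu gamma U pi <= robust_cost mu gamma U pi'.
Proof.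
move=> h0; apply: (sup_continuous_attains_min (D := U) (G := J)).
- exact: compact_policies.
- by exists pi0.
- by move=> m /U_models; exact: J_policy_continuous.
- by move=> pi t hpi; exact: robust_cost_leP.
Qed.

Lemma compact_worst pi : policies pi -> compact (worst pi).
Proof.
move=> hpi.
have -> : worst pi =
    [set m | U m /\ forall m', U m' -> - J m pi <= - J m' pi].
  by apply/seteqP; split => m [Um h]; split => // m' /h; rewrite lerN2.
apply: (compact_sublevel (D := U) (G := fun _ m => - J m pi)) => // _ _ m.
by apply: cvgN; exact: J_model_continuous.
Qed.

(** By [caratheodory], subgradients are the images of pairs (weights, models) of
    a fixed length [N]. These pairs form a compact set, a simplex times a power of
    the set of worst-case models, and the gradient is continuous in the model. *)
Lemma max_gap_attains_min (a0 : A) pi : policies pi ->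
  exists2 g, subdifferential mu gamma U pi g &
    forall g', subdifferential mu gamma U pi g' ->
      max_gap pi g <= max_gap pi g'.
Proof.
move=> hpi.
pose N := #|{: S * A}|.+1.
pose K : set (('I_N -> R) * ('I_N -> model R S A)) :=
  [set l | is_distribution l] `*` [set m | forall i, worst pi (m i)].
pose g (x : ('I_N -> R) * ('I_N -> model R S A)) : S -> A -> R :=
  \sum_i x.1 i *: (grad_total_cost mu gamma (x.2 i) pi : S -> A -> R).
have cK : compact K.
  apply: compact_setX; first exact: compact_simplex.
  apply: (@tychonoff 'I_N (fun=> model R S A) (fun=> worst pi)) => i.
  exact: compact_worst.
have cfst i : continuous (fun x : ('I_N -> R) * ('I_N -> model R S A) => x.1 i).
  move=> x; apply: (continuous_comp (f := fst) (g := fun l : 'I_N -> R => l i)).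
    exact: cvg_fst.
  exact: continuous_coord.
have csnd i : continuous (fun x : ('I_N -> R) * ('I_N -> model R S A) => x.2 i).
  move=> x; apply: (continuous_comp (f := snd)
    (g := fun m : 'I_N -> model R S A => m i)); first exact: cvg_snd.
  exact: continuous_coord.
have cgap pi' : policies pi' ->
    {within K, continuous (fun x => lin_gap pi pi' (g x))}.
  move=> hpi'.
  apply: (@within_continuous_ext R _ K (fun x => \sum_i x.1 i *
    \sum_s \sum_a (pi s a - pi' s a) * grad_total_cost mu gamma (x.2 i) pi s a)
    (fun x => lin_gap pi pi' (g x))).
    by move=> x _; rewrite lin_gap_sum.
  move=> x; apply: cvg_sum => i _; apply: cvgM.
    exact: (continuous_subspaceT (cfst i)).
  apply: cvg_sum => s _; apply: cvg_sum => a _; apply: cvgMl_tmp.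
  apply: (grad_within_continuous gamma_ge0 gamma_lt1
    (m_ := fun x => x.2 i) (pi_ := fun=> pi)) => //.
  - move=> t b y; apply: (continuous_comp
      (f := fun x : ('I_N -> R) * ('I_N -> model R S A) => x.2 i)
      (g := fun m : model R S A => m.1 t b)); first exact: csnd.
    exact: continuous_cost.
  - move=> t b t' y; apply: (continuous_comp
      (f := fun x : ('I_N -> R) * ('I_N -> model R S A) => x.2 i)
      (g := fun m : model R S A => m.2 t b t')); first exact: csnd.
    exact: continuous_kernel.
  - by move=> t b; exact: cst_continuous.
  - by move=> y [_ /(_ i)[Um _]]; exact: U_models.
have K0 : K !=set0.
  have [m wm] := worst_nonempty hpi.
  exists ((fun i => (i == ord0)%:R), fun=> m); split => //=; split.
    by move=> i; case: eqP.
  by rewrite (bigD1 ord0) //= big1 ?addr0 // => i /negbTE ->.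
have [x Kx xmin] := sup_continuous_attains_min cK K0 cgap
  (fun x t _ => max_gap_leP a0 pi (g x) t).
exists (g x).
  exists N, x.1, (fun i => grad_total_cost mu gamma (x.2 i) pi).
  have [[l0 l1] wx] := Kx; split => //.
  by move=> i; exists (x.2 i) => //; exact: wx.
move=> g' /(caratheodory (@coords_inj R S A)) [l [v [l0 l1 Xv ->]]].
have {}Xv i : exists m, worst pi m /\ grad_total_cost mu gamma m pi = v i.
  by have [m wm <-] := Xv i; exists m.
have [m hm] := choice Xv.
have -> : \sum_i l i *: v i = g (l, m).
  by apply: eq_bigr => i _; rewrite (hm i).2.
by apply: xmin; split => //= i; exact: (hm i).1.
Qed.

(** Both sides are compared with [\sum_s gain s], where [gain s] is what the greedy
    policy for the mean action value [Qbar] gains at [s]. The left side is at most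
    a sum of gains weighted by occupancies of [pi'], which are at most 1; the right
    side is at least one weighted by occupancies of [pi], which are at least
    [(1 - gamma) * mu s]. *)
Lemma gap_le_max_gap (a0 : A) pi pi' g :
  policies pi -> policies pi' ->
  is_singleton (worst_kernels mu gamma U pi) \/
    is_singleton (worst_Q mu gamma U pi) ->
  subdifferential mu gamma U pi g ->
  forall mu_min, (forall s, mu_min <= mu s) -> 0 < mu_min ->
  robust_cost mu gamma U pi - robust_cost mu gamma U pi' <=
    ((1 - gamma) * mu_min)^-1 * max_gap pi g.
Proof.
move=> hpi hpi' AorB [n [l [v [l0 l1 Xv ->]]]] mu_min mu_minP mu_min0.
have {Xv} : forall i,
    exists m, worst pi m /\ grad_total_cost mu gamma m pi = v i.
  by move=> i; have [m wm <-] := Xv i; exists m.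
move=> /choice[m hm].
have wm i : worst pi (m i) := (hm i).1.
have mod_m i : is_model (m i) by apply: U_models; have [] := wm i.
pose Q i := action_value gamma (m i) pi.
pose d p i := occupancy mu gamma (m i).2 p.
pose Qbar s a := \sum_i l i * Q i s a.
pose w p s := \sum_i l i * d p i s.
have mix p s a : \sum_i l i * (d p i s * Q i s a) = w p s * Qbar s a.
  apply: convex_mean_mul => //; case: AorB => -[c hc]; [left|right].
    exists (occupancy mu gamma c p s) => i; rewrite /d; congr occupancy.
    have : worst_kernels mu gamma U pi (m i).2.
      by exists (m i) => //; exact: wm.
    by rewrite hc.
  exists (c s a) => i; rewrite /Q.
  have : worst_Q mu gamma U pi (action_value gamma (m i) pi).
    by exists (m i) => //; exact: wm.
  by rewrite hc => /= ->.
have g_gap : 0 < 1 - gamma := horizon_gt0 gamma_lt1.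
have gradE s a : (\sum_i l i *: v i) s a = (1 - gamma)^-1 * (w pi s * Qbar s a).
  rewrite -mix mulr_sumr !fct_sumE; apply: eq_bigr => i _.
  by rewrite -(hm i).2 -[LHS]/(l i * grad_total_cost mu gamma (m i) pi s a)
    /grad_total_cost -/(Q i) -/(d pi i) -mulrA mulrCA.
have w_ge s : (1 - gamma) * mu s <= w pi s.
  rewrite -[leLHS]mul1r -[X in X * _ <= _]l1 mulr_suml; apply: ler_sum => i _.
  by rewrite ler_wpM2l // occupancy_ge //; have [] := mod_m i.
have w_le1 s : w pi' s <= 1.
  rewrite -l1; apply: ler_sum => i _.
  rewrite -[leRHS]mulr1 ler_wpM2l // occupancy_le1 //.
  by have [] := mod_m i.
have w_ge0 s : 0 <= w pi' s.
  apply: sumr_ge0 => i _; apply: mulr_ge0 => //.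
  apply: le_trans (occupancy_ge gamma_ge0 gamma_lt1 mu_distr s _ hpi').
    by rewrite mulr_ge0 ?mu_distr.1 // ltW.
  by have [] := mod_m i.
have [p hp greedy] := exists_greedy a0 Qbar.
pose gain s := \sum_a (pi s a - p s a) * Qbar s a.
have gain_ge p' s : policies p' ->
    \sum_a (pi s a - p' s a) * Qbar s a <= gain s.
  move=> hp'; rewrite /gain; under eq_bigr do rewrite mulrBl.
  under [leRHS]eq_bigr do rewrite mulrBl.
  by rewrite !sumrB lerD2l lerN2 greedy.
have gain0 s : 0 <= gain s.
  apply: le_trans (gain_ge _ s hpi).
  by under eq_bigr do rewrite subrr mul0r; rewrite sumr_const mul0rn.
have upper : robust_cost mu gamma U pi - robust_cost mu gamma U pi' <=
    (1 - gamma)^-1 * \sum_s gain s.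
  apply: (@le_trans _ _ (\sum_i l i * (J (m i) pi - J (m i) pi'))).
    rewrite -[leLHS]mul1r -[X in X * _ <= _]l1 mulr_suml; apply: ler_sum => i _.
    rewrite ler_wpM2l // (robust_costE (wm i)) lerD2l lerN2.
    exact: (robust_cost_leP _ hpi').1 (lexx _) _ (wm i).1.
  under eq_bigr => i _ do rewrite /J performance_difference // mulrCA.
  rewrite -mulr_sumr ler_wpM2l ?invr_ge0 ?(ltW g_gap) //.
  have -> : \sum_i l i * \sum_s occupancy mu gamma (m i).2 pi' s *
        \sum_a (pi s a - pi' s a) * action_value gamma (m i) pi s a =
      \sum_s w pi' s * \sum_a (pi s a - pi' s a) * Qbar s a.
    under eq_bigr do rewrite mulr_sumr.
    rewrite exchange_big /=; apply: eq_bigr => s _.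
    rewrite mulr_sumr; under eq_bigr do rewrite mulrA mulr_sumr.
    rewrite exchange_big /=; apply: eq_bigr => a _.
    rewrite mulrCA -mix mulr_sumr; apply: eq_bigr => i _.
    by rewrite /d /Q; ring.
  apply: ler_sum => s _; apply: le_trans (_ : w pi' s * gain s <= _).
    by rewrite ler_wpM2l // gain_ge.
  by rewrite -[leRHS]mul1r ler_wpM2r.
apply: le_trans upper _.
have lower : mu_min * \sum_s gain s <= max_gap pi (\sum_i l i *: v i).
  apply: le_trans (_ : lin_gap pi p (\sum_i l i *: v i) <= _); last first.
    by apply: (max_gap_leP a0 _ _ _).1.
  rewrite mulr_sumr; apply: ler_sum => s _.
  have -> : \sum_a (pi s a - p s a) * (\sum_i l i *: v i) s a =
      (1 - gamma)^-1 * w pi s * gain s.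
    rewrite mulr_sumr; apply: eq_bigr => a _; rewrite gradE; ring.
  apply: ler_wpM2r => //; apply: le_trans (mu_minP s) _.
  by rewrite ler_pdivlMl.
rewrite invfM -mulrA ler_wpM2l ?invr_ge0 ?(ltW g_gap) //.
by rewrite ler_pdivlMl.
Qed.

End Robust.

Theorem theorem13 (R : realType) (S A : finType) (mu : S -> R) (gamma : R)
    (U : set (model R S A))
    (mu_distr : is_distribution mu)
    (gamma_ge0 : 0 <= gamma) (gamma_lt1 : gamma < 1)
    (U_models : forall m, U m -> is_model m)
    (U_nonempty : U !=set0)
    (U_compact : compact U)
    (mu_gt0 : forall s, 0 < mu s)
    (AorB :
       (forall pi, policies pi -> is_singleton (worst_kernels mu gamma U pi)) \/
       (forall pi, policies pi -> is_singleton (worst_Q mu gamma U pi))) :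
  subgradient_dominant (robust_cost mu gamma U) (subdifferential mu gamma U)
    ((1 - gamma) * setmin (range mu))^-1.
Proof.
move=> pi hpi.
have [s0] : exists s0 : S, True.
  apply: contrapT => noS; have := mu_distr.2; rewrite big1 => [/eqP|s _].
    by rewrite eq_sym oner_eq0.
  by case: noS; exists s.
have [a0] : exists a0 : A, True.
  apply: contrapT => noA; have := (hpi s0).2; rewrite big1 => [/eqP|a _].
    by rewrite eq_sym oner_eq0.
  by case: noA; exists a.
move=> _ _.
have [sm _ mu_min] := arg_minP mu (isT : xpredT s0).
have -> : setmin (range mu) = mu sm.
  by apply: setminE; [exists sm|move=> _ [s _ <-]; exact: mu_min].
have [pib hpib pib_min] := robust_cost_attains_min mu gamma_ge0 gamma_lt1
  U_models U_nonempty U_compact hpi.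
rewrite (setminE (x := robust_cost mu gamma U pib)); first last.
- by move=> _ [pi' hpi' <-]; exact: pib_min.
- by exists pib.
have [g hg gmin] := max_gap_attains_min mu gamma_ge0 gamma_lt1
  U_models U_nonempty U_compact a0 hpi.
rewrite (setminE (x := max_gap pi g)); first last.
- by move=> _ [g' hg' <-]; exact: gmin.
- by exists g.
apply: gap_le_max_gap => //.
- by case: AorB => h; [left|right]; exact: h.
- by move=> s; exact: mu_min.
Qed.
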